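(* Assume exactness and $\mathbf{A}\neq0$. Let $x^0\in\mathbb{R}^n$, $y^0=0\in\mathbb{R}^m$, $\omega\in(0,2)$, $\rho=1-\omega(2-\omega)\lambda_{\min}^+$, and let $\{y^k\}$ be generated by inexact stochastic dual subspace ascent $$y^{k+1}=y^k+\omega\mathbf{S}_k(\mathbf{S}_k^\top\mathbf{A}\mathbf{B}^{-1}\mathbf{A}^\top\mathbf{S}_k)^\dagger\mathbf{S}_k^\top\big(b-\mathbf{A}(x^0+\mathbf{B}^{-1}\mathbf{A}^\top y^k)\big)+\epsilon_d^k,$$ where the (possibly random) errors $\epsilon_d^k\in\mathbb{R}^m$ satisfy $$\mathbb{E}\big[\|\mathbf{B}^{-1}\mathbf{A}^\top\epsilon_d^k\|_{\mathbf{B}}^2\mid y^k,\mathbf{S}_k\big]\le 2q^2\big[D(y^* )-D(y^k)\big]$$ for a constant $0\le q<1-\sqrt\rho$, with $y^*$ any maximizer of $D$. Then for all $k\ge0$ $$\mathbb{E}[D(y^* )-D(y^k)]\le(\sqrt\rho+q)^{2k}\big[D(y^* )-D(y^0)\big].$$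
   Context: Let $\mathbf{A}\in\mathbb{R}^{m\times n}$ and $b\in\mathbb{R}^m$ be such that the linear system $\mathbf{A}x=b$ is consistent. Let $\mathbf{B}\in\mathbb{R}^{n\times n}$ be symmetric positive definite, $\|x\|_{\mathbf{B}}=\sqrt{x^\top\mathbf{B}x}$, $\|v\|_{\mathbf{B}^{-1}}^2=v^\top\mathbf{B}^{-1}v$. For the given $x^0$, the dual function is $D(y)=(b-\mathbf{A}x^0)^\top y-\tfrac12\|\mathbf{A}^\top y\|_{\mathbf{B}^{-1}}^2$, $y\in\mathbb{R}^m$ (bounded above, maximum attained). Let $\mathcal{D}$ be a probability distribution over random real matrices $\mathbf{S}$ with $m$ rows (any number of columns). For $\mathbf{S}\sim\mathcal{D}$ set $\mathbf{H}=\mathbf{S}(\mathbf{S}^\top\mathbf{A}\mathbf{B}^{-1}\mathbf{A}^\top\mathbf{S})^\dagger\mathbf{S}^\top$ ($\dagger$ denotes the Moore–Penrose pseudoinverse) and $\mathbf{Z}=\mathbf{A}^\top\mathbf{H}\mathbf{A}$; $\mathbb{E}[\mathbf{Z}]$ is assumed finite. Let $\mathbf{W}=\mathbf{B}^{-1/2}\mathbb{E}[\mathbf{Z}]\mathbf{B}^{-1/2}$ (its eigenvalues lie in $[0,1]$); $\lambda_{\min}^+$ is its smallest nonzero eigenvalue. Exactness means $\mathrm{Null}(\mathbb{E}[\mathbf{Z}])=\mathrm{Null}(\mathbf{A})$. The matrices $\mathbf{S}_k$ are drawn i.i.d. from $\mathcal{D}$ ($\mathbf{S}_k$ independent of $y^k$).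 *)

(* Defs.v *)
From HB Require Import structures.
From mathcomp Require Import all_boot all_order all_algebra.
From mathcomp Require Import all_classical all_reals all_analysis.
Set Implicit Arguments. Unset Strict Implicit. Unset Printing Implicit Defensive.
Import Order.TTheory GRing.Theory Num.Theory.
Local Open Scope classical_set_scope.
Local Open Scope ring_scope.

Section LinAlg.
Variable R : realType.

Definition penrose p q (M : 'M[R]_(p, q)) (X : 'M[R]_(q, p)) : Prop :=
  [/\ M *m X *m M = M, X *m M *m X = X,
      (M *m X)^T = M *m X & (X *m M)^T = X *m M].

(* Moore--Penrose pseudoinverse (the unique X satisfying the Penrose
   conditions; it always exists over the reals). *)
Definition mp_pinv p q (M : 'M[R]_(p, q)) : 'M[R]_(q, p) :=
  xget 0 [set X | penrose M X].

Definition sym_mx n (M : 'M[R]_n) : Prop := M^T = M.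
Definition posdef n (M : 'M[R]_n) : Prop :=
  sym_mx M /\ forall v : 'cV[R]_n, v != 0 -> 0 < (v^T *m M *m v) 0 0.

Definition inv_sqrt_mx n (B : 'M[R]_n) : 'M[R]_n :=
  xget 0 [set C | posdef C /\ C *m C = invmx B].

Definition sqnormB n (B : 'M[R]_n) (x : 'cV[R]_n) : R := (x^T *m B *m x) 0 0.

Definition dualf m n (A : 'M[R]_(m, n)) (B : 'M[R]_n) (b : 'cV[R]_m)
    (x0 : 'cV[R]_n) (y : 'cV[R]_m) : R :=
  ((b - A *m x0)^T *m y) 0 0 - 2^-1 * sqnormB (invmx B) (A^T *m y).

(* H = S (S^T A B^{-1} A^T S)^dagger S^T for a sketch S with any number of
   columns (packed as a dependent pair). *)
Definition Hof m n (A : 'M[R]_(m, n)) (B : 'M[R]_n)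
    (s : {p : nat & 'M[R]_(m, p)}) : 'M[R]_m :=
  let S := projT2 s in
  S *m mp_pinv (S^T *m (A *m invmx B *m A^T) *m S) *m S^T.

Definition Zof m n (A : 'M[R]_(m, n)) (B : 'M[R]_n)
    (s : {p : nat & 'M[R]_(m, p)}) : 'M[R]_n :=
  A^T *m Hof A B s *m A.

(* iterates of inexact stochastic dual subspace ascent, y^0 = 0,
   H k = S_k (S_k^T A B^{-1} A^T S_k)^dagger S_k^T, e k = eps_d^k *)
Fixpoint isdsa m n (A : 'M[R]_(m, n)) (B : 'M[R]_n) (b : 'cV[R]_m)
    (x0 : 'cV[R]_n) (w : R) (H : nat -> 'M[R]_m) (e : nat -> 'cV[R]_m)
    (k : nat) : 'cV[R]_m :=
  match k with
  | 0 => 0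
  | k'.+1 =>
    let yk := isdsa A B b x0 w H e k' in
    yk + w *: (H k' *m (b - A *m (x0 + invmx B *m A^T *m yk))) + e k'
  end.

Definition min_pos_eig n (W : 'M[R]_n) (lam : R) : Prop :=
  [/\ eigenvalue W lam, lam != 0 &
      forall mu, eigenvalue W mu -> mu != 0 -> lam <= mu].

End LinAlg.

Section Prob.
Variable R : realType.
Local Open Scope ereal_scope.

Definition preim_vec d (Om : measurableType d) m (Y : Om -> 'cV[R]_m)
  : set (set Om) :=
  [set E | exists (i : 'I_m) (C : set R), measurable C /\
             E = (fun om => Y om i 0%R) @^-1` C].

Definition preim_rv d (Om : measurableType d) dT (T : measurableType dT)
    (X : Om -> T) : set (set Om) :=
  [set E | exists C : set T, measurable C /\ E = X @^-1` C].

Definition indep d (Om : measurableType d) (P : probability Om R)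
    (F G : set (set Om)) : Prop :=
  forall E1 E2, F E1 -> G E2 -> P (E1 `&` E2) = P E1 * P E2.

Definition mutually_indep d (Om : measurableType d) (P : probability Om R)
    (F : nat -> set (set Om)) : Prop :=
  forall (J : seq nat) (E : nat -> set Om), uniq J ->
    (forall j, j \in J -> F j (E j)) ->
    P (\big[setI/setT]_(j <- J) E j) = \prod_(j <- J) P (E j).

(* E[X | G] <= Y a.s. for nonnegative X and G-measurable Y, written out via
   the defining property of conditional expectation *)
Definition cond_exp_le d (Om : measurableType d) (P : probability Om R)
    (G : set (set Om)) (X Y : Om -> R) : Prop :=
  forall E, G E -> \int[P]_(om in E) (X om)%:E <= \int[P]_(om in E) (Y om)%:E.

End Prob.

(* Main.v *)
Require Import Defs.
From HB Require Import structures.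
From mathcomp Require Import all_boot all_order all_algebra.
From mathcomp Require Import all_classical all_reals all_analysis.
From mathcomp Require Import measurable_realfun complex ring lra.
Set Implicit Arguments. Unset Strict Implicit. Unset Printing Implicit Defensive.
Import Order.TTheory GRing.Theory Num.Theory.
Local Open Scope classical_set_scope.
Local Open Scope ring_scope.

(** Let M = A B^-1 A^T and u = y - y*. Maximality gives M y* = b - A x0, so the
    dual gap is u^T M u / 2 and, up to the error, one step sends u to
    u - w H M u. Since H is symmetric with H M H = H, this step changes u^T M u
    into u^T M u - w (2 - w) v^T Z v with v = B^-1 A^T u. By independence and
    Tonelli, Z may be replaced by E[Z] in the expectation; exactness puts
    B^(-1/2) A^T u in the range of W, where the Rayleigh quotient of W is at
    least lambda_min^+. Hence the error-free step contracts the mean square of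
    the M-seminorm by rho, and Minkowski's inequality in L^2 adds q. *)

(** * Symmetric matrices on their range *)

Section RealSpectral.
Local Open Scope sesquilinear_scope.

Lemma quad_diag_mx (F : comRingType) n (d : 'rV[F]_n) (x : 'cV_n) (y : 'rV_n) :
  (y *m diag_mx d *m x) 0 0 = \sum_i y 0 i * d 0 i * x i 0.
Proof.
rewrite mxE; apply: eq_bigr => i _; congr (_ * _).
by rewrite mul_mx_diag mxE.
Qed.

(** Unitary diagonalisation turns the form into the sum of [d_i (d_i - lam) d_i |(P z)_i|^2] over
    the eigenvalues [d_i], which are real. *)
Lemma hermitian_cubic_ge0 (C : numClosedFieldType) n (V : 'M[C]_n) (lam : C)
    (z : 'cV_n) :
  V \is hermsymmx ->
  (forall d, d \is Num.real -> eigenvalue V d -> 0 <= d * (d - lam) * d) ->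
  0 <= (z^t* *m (V *m (V - lam%:M) *m V) *m z) 0 0.
Proof.
move=> hV ev_ge0.
have /orthomx_spectralP := hermitian_normalmx hV.
have /mxOverP dR := hermitian_spectral_diag_real hV.
have PU := spectral_unitarymx V.
have Pu := spectral_unit V.
move: dR PU Pu; set P := spectralmx V; set d := spectral_diag V => dR PU Pu VE.
have PV : P *m V = diag_mx d *m P by rewrite {1}VE !mulmxA mulmxV // mul1mx.
(* Each row of [P] is a left eigenvector, nonzero because [P] is invertible. *)
have ev i : eigenvalue V (d 0 i).
  apply/eigenvalueP; exists (row i P).
    by rewrite -row_mul PV; apply/rowP => j; rewrite mul_diag_mx !mxE.
  apply: contraTneq isT => P0; have := congr1 (mulmx^~ (invmx P)) P0.
  rewrite rowE mulmxK // mul0mx => /matrixP/(_ 0 i)/eqP.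
  by rewrite !mxE !eqxx oner_eq0.
have PVl : P *m (V - lam%:M) = diag_mx (d - const_mx lam) *m P.
  rewrite mulmxBr PV scalar_mxC -mulmxBl linearB /=; congr ((_ - _) *m P).
  by rewrite diag_const_mx.
have -> : z^t* *m (V *m (V - lam%:M) *m V) *m z = (P *m z)^t* *m
    diag_mx (\row_i (d 0 i * (d 0 i - lam) * d 0 i)) *m (P *m z).
  rewrite trmx_mul map_mxM /= -(invmx_unitary PU) -!mulmxA; congr (_ *m _).
  rewrite -[LHS](mulKmx Pu); congr (_ *m _).
  rewrite !mulmxA PV -(mulmxA _ P (_ - _)) PVl mulmxA -(mulmxA _ P V) PV.
  rewrite !mulmxA !mulmx_diag.
  by congr (diag_mx _ *m P *m _); apply/rowP => i; rewrite !mxE.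
rewrite quad_diag_mx; apply: sumr_ge0 => i _.
by rewrite !mxE mulrAC [_^* * _]mulrC mulr_ge0 ?mul_conjC_ge0 ?ev_ge0.
Qed.

Lemma map_real_hermsymmx (R : rcfType) n (W : 'M[R]_n) :
  W^T = W -> map_mx (real_complex R) W \is hermsymmx.
Proof.
move=> sW; apply/is_hermitianmxP; rewrite expr0 scale1r.
apply/matrixP => i j; rewrite !mxE /= -{1}sW mxE.
exact/esym/conjc_real.
Qed.

(* With v = W z, the difference of the two sides is z^T W (W - lam) W z, and
   d (d - lam) d >= 0 for every eigenvalue d of W, the zero one included. *)
Lemma rayleigh_ge_min_eig (R : rcfType) n (W : 'M[R]_n) lam (z : 'cV_n) :
  W^T = W -> (forall mu, eigenvalue W mu -> mu != 0 -> lam <= mu) ->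
  lam * ((W *m z)^T *m (W *m z)) 0 0 <= ((W *m z)^T *m W *m (W *m z)) 0 0.
Proof.
move=> sW min_lam.
(* The spectral theorem is applied over [R[i]]. The vector [z] stays real there, so its transpose is
   its conjugate transpose, and real eigenvalues of the complexified [W] are eigenvalues of [W]. *)
pose f : {rmorphism R -> R[i]} := real_complex R.
rewrite -subr_ge0.
set Q := (X in 0 <= X).
have -> : Q = (z^T *m (W *m (W - lam%:M) *m W) *m z) 0 0.
  rewrite /Q trmx_mul sW mulmxBr mulmxBl mulmxBr mulmxBl !mulmxA [in RHS]mxE.
  congr (_ + _); rewrite [in RHS]mxE; congr (- _).
  by rewrite scalar_mxC -!mulmxA mul_scalar_mx [RHS]mxE.
set q := z^T *m _ *m z.
have zE : map_mx f z^T = (map_mx f z)^t*.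
  by apply/matrixP => i j; rewrite !mxE; exact/esym/conjc_real.
rewrite -lecR (_ : (q 0 0)%:C%C = map_mx f q 0 0); last by rewrite [RHS]mxE.
rewrite /q !map_mxM map_mxB map_scalar_mx zE.
apply: hermitian_cubic_ge0 => [|d]; first exact: map_real_hermsymmx.
move=> /complex_realP[r ->]; rewrite -[r%:C%C]/(f r) eigenvalue_map => evr.
rewrite -rmorphB -!rmorphM lecR.
have [->|r0] := eqVneq r 0; first by rewrite !mul0r.
by rewrite mulrAC mulr_ge0 ?subr_ge0 ?min_lam // -expr2 sqr_ge0.
Qed.

End RealSpectral.

(** * Quadratic forms, pseudoinverses and the dual function *)

Definition bform (R : pzRingType) n (M : 'M[R]_n) (x y : 'cV_n) : R :=
  (x^T *m M *m y) 0 0.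

Section BilinearForm.
Variables (R : realFieldType) (n : nat) (M : 'M[R]_n).
Implicit Types x y z : 'cV[R]_n.

Lemma bformDl x y z : bform M (x + y) z = bform M x z + bform M y z.
Proof. by rewrite /bform linearD /= !mulmxDl mxE. Qed.

Lemma bformDr x y z : bform M x (y + z) = bform M x y + bform M x z.
Proof. by rewrite /bform mulmxDr mxE. Qed.

Lemma bformZl a x y : bform M (a *: x) y = a * bform M x y.
Proof. by rewrite /bform linearZ /= -!scalemxAl mxE. Qed.

Lemma bformZr a x y : bform M x (a *: y) = a * bform M x y.
Proof. by rewrite /bform -scalemxAr mxE. Qed.

Lemma bformNl x y : bform M (- x) y = - bform M x y.
Proof. by rewrite -scaleN1r bformZl mulN1r. Qed.

Lemma bformNr x y : bform M x (- y) = - bform M x y.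
Proof. by rewrite -scaleN1r bformZr mulN1r. Qed.

Definition bformE := (bformDl, bformDr, bformNl, bformNr, bformZl, bformZr).

Hypothesis symM : M^T = M.

Lemma bformC x y : bform M x y = bform M y x.
Proof.
rewrite /bform; transitivity ((x^T *m M *m y)^T 0 0); first by rewrite [RHS]mxE.
by rewrite !trmx_mul trmxK symM mulmxA.
Qed.

Hypothesis psdM : forall x, 0 <= bform M x x.

(** Positivity of the form at [t *: x - y], expanded and divided by [t]. *)
Lemma bform_add_young t x y : 0 < t ->
  bform M (x + y) (x + y) <= (1 + t) * bform M x x + (1 + t^-1) * bform M y y.
Proof.
move=> t0; have := psdM (t *: x - y); rewrite !bformE (bformC y x) => h.
rewrite -subr_ge0 -(pmulr_rge0 _ t0).
have -> : t * ((1 + t) * bform M x x + (1 + t^-1) * bform M y y -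
    (bform M x x + bform M x y + (bform M x y + bform M y y))) =
  t * (t * bform M x x) - t * bform M x y - (t * bform M x y - bform M y y).
  by field; rewrite gt_eqF.
by move: h; congr (0 <= _); ring.
Qed.

End BilinearForm.

Lemma bform_sum (R : comRingType) n (M : 'M[R]_n) (x y : 'cV_n) :
  bform M x y = \sum_i \sum_j x i 0 * y j 0 * M i j.
Proof.
rewrite /bform mxE exchange_big /=; apply: eq_bigr => j _.
rewrite mxE big_distrl /=; apply: eq_bigr => i _.
by rewrite mxE mulrAC.
Qed.

Lemma bform_trmx_mul (R : comRingType) m n (M : 'M[R]_m) (X : 'M[R]_(m, n)) x :
  bform M (X *m x) (X *m x) = bform (X^T *m M *m X) x x.
Proof. by rewrite /bform trmx_mul !mulmxA. Qed.

Section PosDef.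
Variables (R : realType) (n : nat).
Implicit Types B C : 'M[R]_n.

Lemma posdef_unitmx B : posdef B -> B \in unitmx.
Proof.
move=> [symB posB]; rewrite -row_free_unit -kermx_eq0.
apply/eqP/row_matrixP => i.
rewrite row0; apply: trmx_inj; rewrite trmx0; apply: contrapT => /eqP kn0.
have := posB _ kn0; rewrite trmxK -row_mul mulmx_ker row0 mul0mx mxE.
by rewrite ltxx.
Qed.

Lemma posdef_invmx_sym B : posdef B -> (invmx B)^T = invmx B.
Proof. by case=> symB _; rewrite trmx_inv symB. Qed.

Lemma posdef_invmx_psd B (x : 'cV_n) : posdef B -> 0 <= bform (invmx B) x x.
Proof.
move=> pB; have uB := posdef_unitmx pB.
have -> : bform (invmx B) x x = bform B (invmx B *m x) (invmx B *m x).
  by rewrite bform_trmx_mul posdef_invmx_sym // mulVmx // mul1mx.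
have [->|x0] := eqVneq (invmx B *m x) 0; first by rewrite /bform mulmx0 mxE.
by apply: ltW; apply: pB.2.
Qed.

End PosDef.

Section PseudoInverse.
Variable R : realType.

(** Splits off the default value 0 of [xget]; the outer identity and the symmetry proved below hold
    for 0 as well. *)
Lemma mp_pinvP p q (M : 'M[R]_(p, q)) :
  penrose M (mp_pinv M) \/ mp_pinv M = 0.
Proof.
rewrite /mp_pinv; have [[X MX]|noX] := pselect (exists X, penrose M X).
  by left; apply: (xgetPex 0); exists X.
by right; apply: xgetPN => X MX; apply: noX; exists X.
Qed.

Lemma mp_pinv_outer p q (M : 'M[R]_(p, q)) :
  mp_pinv M *m M *m mp_pinv M = mp_pinv M.
Proof. by have [[]|->] := mp_pinvP M; rewrite ?mulmx0. Qed.

(** Symmetry of the four products gives [M X = M Y] and [X M = Y M], whence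
    [X = X M X = Y M X = Y M Y = Y]. *)
Lemma penrose_uniq p q (M : 'M[R]_(p, q)) X Y :
  penrose M X -> penrose M Y -> X = Y.
Proof.
move=> [MX XM symMX symXM] [MY YM symMY symYM].
have MXY : M *m X = M *m Y.
  by rewrite -symMX -{1}MY -mulmxA trmx_mul symMX symMY mulmxA MX.
have XYM : X *m M = Y *m M.
  transitivity ((X *m M) *m (Y *m M)).
    by rewrite mulmxA -(mulmxA X) -mulmxA MY.
  by rewrite -symXM -symYM -trmx_mul mulmxA -(mulmxA Y) -mulmxA MX.
by rewrite -XM XYM -mulmxA MXY mulmxA YM.
Qed.

(** For symmetric [M] the transpose of a pseudoinverse again satisfies the Penrose conditions, so
    uniqueness applies. *)
Lemma mp_pinv_sym p (M : 'M[R]_p) : M^T = M -> (mp_pinv M)^T = mp_pinv M.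
Proof.
move=> symM; have [MX|->] := mp_pinvP M; last by rewrite trmx0.
apply: penrose_uniq (MX); case: MX; set X := mp_pinv M => M1 M2 M3 M4.
have MXT : M *m X^T = X *m M by rewrite -{1}symM -trmx_mul M4.
have XTM : X^T *m M = M *m X by rewrite -{1}symM -trmx_mul M3.
split.
- by rewrite -[RHS]symM -{3}M1 !trmx_mul symM mulmxA.
- by rewrite -{3}M2 !trmx_mul symM mulmxA.
- by rewrite MXT.
- by rewrite XTM.
Qed.

End PseudoInverse.

Section DualAscent.
Variables (R : realType) (m n : nat) (A : 'M[R]_(m, n)) (B : 'M[R]_n).
Hypothesis pB : posdef B.

Let uB : B \in unitmx := posdef_unitmx pB.
Let sBi : (invmx B)^T = invmx B := posdef_invmx_sym pB.

Definition gram := A *m invmx B *m A^T.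

Lemma gram_sym : gram^T = gram.
Proof. by rewrite /gram !trmx_mul trmxK sBi mulmxA. Qed.

Lemma bform_gram u : bform gram u u = bform (invmx B) (A^T *m u) (A^T *m u).
Proof. by rewrite bform_trmx_mul trmxK. Qed.

Lemma gram_psd u : 0 <= bform gram u u.
Proof. by rewrite bform_gram; exact: posdef_invmx_psd. Qed.

(** Puts the error term in the same seminorm as the dual gap. *)
Lemma sqnormB_gram e : sqnormB B (invmx B *m A^T *m e) = bform gram e e.
Proof.
rewrite -[LHS]/(bform _ _ _) -mulmxA bform_trmx_mul sBi mulVmx // mul1mx.
by rewrite bform_gram.
Qed.

Lemma Hof_sym s : (Hof A B s)^T = Hof A B s.
Proof.
rewrite /Hof; case: s => p S /=; rewrite -/gram.
have sK : (S^T *m gram *m S)^T = S^T *m gram *m S.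
  by rewrite trmx_mul [(S^T *m gram)^T]trmx_mul trmxK gram_sym mulmxA.
by rewrite !trmx_mul trmxK (mp_pinv_sym sK) mulmxA.
Qed.

(** Inherited from the outer identity of the pseudoinverse of [S^T gram S]. It makes the quadratic
    term of a step collapse onto the linear one. *)
Lemma Hof_outer s : Hof A B s *m gram *m Hof A B s = Hof A B s.
Proof.
rewrite /Hof; case: s => p S /=.
by rewrite -/gram -[in RHS]mp_pinv_outer !mulmxA.
Qed.

Lemma Zof_sym s : (Zof A B s)^T = Zof A B s.
Proof.
by rewrite /Zof trmx_mul [(A^T *m _)^T]trmx_mul trmxK Hof_sym mulmxA.
Qed.

(** Since [A v = gram u], the cross term is [-2 w v^T Z v]; by [Hof_outer] the quadratic term is
    [w^2 v^T Z v]. Together they give the factor [w (2 - w)]. *)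
Lemma bform_gram_step w s u :
  let u' := u - w *: (Hof A B s *m (gram *m u)) in
  let v := invmx B *m A^T *m u in
  bform gram u' u' = bform gram u u - w * (2 - w) * bform (Zof A B s) v v.
Proof.
move=> u' v; rewrite /u' !bformE (bformC gram_sym _ u).
have -> : bform gram u (Hof A B s *m (gram *m u)) = bform (Zof A B s) v v.
  rewrite /v bform_trmx_mul /bform /Zof trmx_mul sBi trmxK.
  by rewrite -[A *m _]/(A *m invmx B) /gram !mulmxA.
have -> : bform gram (Hof A B s *m (gram *m u)) (Hof A B s *m (gram *m u)) =
    bform (Zof A B s) v v.
  rewrite bform_trmx_mul Hof_sym Hof_outer bform_trmx_mul gram_sym.
  by rewrite /v bform_trmx_mul /Zof trmx_mul sBi trmxK /gram !mulmxA.
by ring.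
Qed.

Section DualGap.
Variables (b : 'cV[R]_m) (x0 : 'cV[R]_n) (ystar : 'cV[R]_m).
Hypothesis ymax : forall y, dualf A B b x0 y <= dualf A B b x0 ystar.

(** The second-order Taylor expansion, exact because the dual function is quadratic;
    [b - A x0 - gram y] is its gradient at [y]. *)
Let dualf_add y z : dualf A B b x0 (y + z) = dualf A B b x0 y
  + ((b - A *m x0 - gram *m y)^T *m z) 0 0 - 2^-1 * bform gram z z.
Proof.
have E t : sqnormB (invmx B) (A^T *m t) = bform gram t t by rewrite bform_gram.
rewrite /dualf !E !bformE (bformC gram_sym z y).
have -> : ((b - A *m x0 - gram *m y)^T *m z) 0 0 =
    ((b - A *m x0)^T *m z) 0 0 - bform gram y z.
  by rewrite linearB /= mulmxBl (trmx_mul gram) gram_sym mxE [X in _ + X]mxE.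
by rewrite mulmxDr mxE; field.
Qed.

(** Moving from [ystar] by [s] times the gradient [r] cannot increase the dual function, so
    [s |r|^2 <= s^2 r^T gram r / 2] for every [s]; a small positive [s] then forces [r = 0]. *)
Lemma dual_max_stationary : gram *m ystar = b - A *m x0.
Proof.
set r := b - A *m x0 - gram *m ystar; suff: r = 0.
  by move=> /eqP; rewrite subr_eq0 => /eqP.
have h s : s * (r^T *m r) 0 0 <= 2^-1 * (s ^+ 2 * bform gram r r).
  have := ymax (ystar + s *: r).
  rewrite dualf_add -/r -scalemxAr mxE bformZl bformZr.
  by rewrite -addrA gerDl subr_le0 (mulrA s s) -expr2.
have rrE : (r^T *m r) 0 0 = \sum_i r i 0 ^+ 2.
  by rewrite mxE; apply: eq_bigr => i _; rewrite mxE -expr2.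
have rr0 : (r^T *m r) 0 0 = 0.
  apply/eqP; rewrite eq_le; apply/andP; split; last first.
    by rewrite rrE sumr_ge0 // => i _; rewrite sqr_ge0.
  rewrite leNgt; apply/negP => rr; set K := bform gram r r in h.
  have K0 : 0 <= K by exact: gram_psd.
  (* Adding 1 keeps the denominator positive when [K = 0]. This step size yields
     [c <= c K / (2 (K + 1)) < c], a contradiction. *)
  have := h ((r^T *m r) 0 0 / (K + 1)); set c := (r^T *m r) 0 0 in rr *.
  have cK : 0 < c / (K + 1) by rewrite divr_gt0 // ltr_wpDl.
  set a := c / (K + 1) in cK *.
  rewrite (_ : 2^-1 * _ = a * (2^-1 * (a * K))); last by ring.
  rewrite ler_pM2l // /a.
  rewrite leNgt => /negP; apply.
  have -> : 2^-1 * (c / (K + 1) * K) = c * (K / (2 * (K + 1))).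
    by field; rewrite gt_eqF // ltr_wpDl.
  rewrite gtr_pMr // ltr_pdivrMr; last by lra.
  by lra.
apply/colP => i; rewrite [RHS]mxE; apply/eqP; rewrite -sqrf_eq0; apply/eqP.
move: rr0; rewrite rrE => /psumr_eq0P; apply => // j _; exact: sqr_ge0.
Qed.

(** Expansion about [ystar], where the gradient vanishes. *)
Lemma dual_gap y : dualf A B b x0 ystar - dualf A B b x0 y =
  2^-1 * bform gram (y - ystar) (y - ystar).
Proof.
have := dualf_add ystar (y - ystar); rewrite addrC subrK => ->.
by rewrite dual_max_stationary subrr trmx0 mul0mx mxE; ring.
Qed.

End DualGap.

(** With [C = B^(-1/2)], the vector [x = C A^T u] lies in the range of [W], and [C C = B^-1] gives
    [x^T x = u^T gram u] and [x^T W x = v^T Z v]; the Rayleigh bound at [x] is the claim. *)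
Lemma spectral_gap (Z : 'M[R]_n) lam u :
  Z^T = Z ->
  (forall v : 'cV[R]_n, Z *m v = 0 -> A *m v = 0) ->
  min_pos_eig (inv_sqrt_mx B *m Z *m inv_sqrt_mx B) lam ->
  lam * bform gram u u <=
    bform Z (invmx B *m A^T *m u) (invmx B *m A^T *m u).
Proof.
move=> sZ exact_Z [eigW lam0 minW]; set v := invmx B *m A^T *m u.
set C := inv_sqrt_mx B in eigW minW.
have [pC CC] : posdef C /\ C *m C = invmx B.
  rewrite /C /inv_sqrt_mx.
  have [[X HX]|noX] := pselect (exists X, posdef X /\ X *m X = invmx B).
    by apply: (@xgetPex _ 0 [set C | posdef C /\ C *m C = invmx B]); exists X.
  (* [inv_sqrt_mx] defaults to 0, which has no nonzero eigenvalue. *)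
  have C0 : C = 0 by apply: xgetPN => X HX; apply: noX; exists X.
  move: eigW; rewrite C0 mulmx0 => /eigenvalueP[x]; rewrite mulmx0 => /esym/eqP.
  by rewrite scaler_eq0 (negbTE lam0) /= => ->.
have sC : C^T = C by case: pC.
have uC := posdef_unitmx pC.
set W := C *m Z *m C in eigW minW.
have sW : W^T = W by rewrite /W !trmx_mul sC sZ mulmxA.
(* Row-space inclusion is tested on the cokernel of [W]: cancelling the invertible left factor [C]
   leaves [Z C coker = 0], and exactness, applied column by column, gives [A C coker = 0]. *)
have /submxP[X ACE] : (A *m C <= W)%MS.
  have exact_Zmx (V : 'M[R]_n) : Z *m V = 0 -> A *m V = 0.
    move=> ZV; apply/matrixP => i j; transitivity (col j (A *m V) i 0).
      by rewrite [RHS]mxE.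
    by rewrite colE -mulmxA exact_Z ?[RHS]mxE ?mxE // mulmxA ZV mul0mx.
  rewrite submxE -mulmxA; apply/eqP/exact_Zmx.
  have CZ0 : C *m (Z *m (C *m cokermx W)) = 0.
    by rewrite mulmxA mulmxA; exact: mulmx_coker.
  by rewrite -[LHS](mulKmx uC) CZ0 mulmx0.
have xE : C *m A^T *m u = W *m (X^T *m u).
  by rewrite mulmxA -[W]sW -trmx_mul -ACE trmx_mul sC.
have := rayleigh_ge_min_eig (X^T *m u) sW minW; rewrite -xE.
have -> : ((C *m A^T *m u)^T *m (C *m A^T *m u)) 0 0 = bform gram u u.
  by rewrite bform_gram /bform -CC !trmx_mul trmxK sC !mulmxA.
have -> : ((C *m A^T *m u)^T *m W *m (C *m A^T *m u)) 0 0 = bform Z v v => //.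
by rewrite /v -CC /bform /W !trmx_mul !trmxK sC !mulmxA.
Qed.

End DualAscent.

(** * Random matrices and independence *)

Section MeasurableMatrix.
Variables (R : realType) (d : measure_display) (X : measurableType d).

Definition measurable_mx p q (F : X -> 'M[R]_(p, q)) :=
  forall i j, measurable_fun setT (fun x => F x i j).

Lemma measurable_mx_cst p q (M : 'M[R]_(p, q)) : measurable_mx (fun=> M).
Proof. by move=> i j; exact: measurable_cst. Qed.

Lemma measurable_mxD p q (F G : X -> 'M[R]_(p, q)) :
  measurable_mx F -> measurable_mx G -> measurable_mx (fun x => F x + G x).
Proof.
move=> mF mG i j; under eq_fun do rewrite mxE.
exact: measurable_funD.
Qed.

Lemma measurable_mxZ p q a (F : X -> 'M[R]_(p, q)) :
  measurable_mx F -> measurable_mx (fun x => a *: F x).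
Proof.
move=> mF i j; under eq_fun do rewrite mxE.
by apply: measurable_funM => //; exact: measurable_cst.
Qed.

Lemma measurable_mxB p q (F G : X -> 'M[R]_(p, q)) :
  measurable_mx F -> measurable_mx G -> measurable_mx (fun x => F x - G x).
Proof.
move=> mF mG; under eq_fun do rewrite -scaleN1r.
by apply: measurable_mxD => //; exact: measurable_mxZ.
Qed.

Lemma measurable_mxM p q r (F : X -> 'M[R]_(p, q)) (G : X -> 'M[R]_(q, r)) :
  measurable_mx F -> measurable_mx G -> measurable_mx (fun x => F x *m G x).
Proof.
move=> mF mG i j; under eq_fun do rewrite mxE.
by apply: measurable_sum => k; exact: measurable_funM.
Qed.

Lemma measurable_bform p (F : X -> 'M[R]_p) (x y : X -> 'cV[R]_p) :
  measurable_mx F -> measurable_mx x -> measurable_mx y ->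
  measurable_fun setT (fun t => bform (F t) (x t) (y t)).
Proof.
move=> mF mx my; have mxT : measurable_mx (fun t => (x t)^T).
  by move=> i j; under eq_fun do rewrite mxE; exact: mx.
exact: (measurable_mxM (measurable_mxM mxT mF) my).
Qed.

End MeasurableMatrix.

Lemma measurable_mx_comp (R : realType) d d' (X : measurableType d)
    (Y : measurableType d') (f : X -> Y) p q (F : Y -> 'M[R]_(p, q)) :
  measurable_fun setT f -> measurable_mx F -> measurable_mx (F \o f).
Proof. by move=> mf mF i j; apply: measurableT_comp (mF i j) mf. Qed.

(** Composing with this identity carries measurability for the coarser sigma-algebra generated by
    [G] over to [Om]. *)
Lemma measurable_id_g_sigma d (Om : measurableType d) (G : set (set Om)) :
  G `<=` measurable -> measurable_fun setT (id : Om -> g_sigma_algebraType G).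
Proof.
move=> mG _ C mC; rewrite setTI; change (measurable (C : set Om)).
move: mC; apply: smallest_sub => //; exact: sigma_algebra_measurable.
Qed.

Section IndependentTonelli.
Local Open Scope ereal_scope.
Variables (R : realType) (d dT : measure_display).
Variables (Om : measurableType d) (T : measurableType dT).
Variables (P : probability Om R) (D : probability T R).
Variables (G : set (set Om)) (X : Om -> T).
Hypothesis mG : G `<=` measurable.
Hypothesis mX : measurable_fun setT X.
Hypothesis lawX : forall C, measurable C -> P (X @^-1` C) = D C.
Hypothesis indXG : indep P <<s preim_rv X>> <<s G>>.

(* The law of (om, X om) on (Om, <<s G >>) x T is a product measure. *)
Let OmG : measurableType _ := g_sigma_algebraType G.

Let forget : Om -> OmG := id.

Let measurable_forget : measurable_fun setT forget := measurable_id_g_sigma mG.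

HB.instance Definition _ :=
  @isMeasurableFun.Build _ _ _ _ forget measurable_forget.

Let paired (om : Om) : OmG * T := (forget om, X om).

Let measurable_paired : measurable_fun setT paired.
Proof. exact: measurable_fun_pair. Qed.

HB.instance Definition _ :=
  @isMeasurableFun.Build _ _ _ _ paired measurable_paired.

(** Independence identifies the joint law with the product measure on rectangles, hence everywhere
    by uniqueness; Tonelli then averages over [X] with the [G]-measurable argument frozen. *)
Lemma ge0_integral_indep (g : OmG * T -> \bar R) :
  measurable_fun setT g -> (forall z, 0 <= g z) ->
  \int[P]_om g (om, X om) = \int[P]_om \int[D]_t g (om, t).
Proof.
move=> mg g0.
pose PG : probability OmG R := distribution P forget.
pose PT : probability _ R := distribution P paired.
have rect C E : measurable C -> measurable E -> PT (C `*` E) = PG C * D E.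
  move=> mC mE; rewrite -lawX //.
  transitivity (P (X @^-1` E `&` (C : set Om))); first by rewrite setIC.
  rewrite (indXG _ mC) 1?muleC //.
  by apply: sub_sigma_algebra; exists E.
transitivity (\int[PT]_z g z).
  by rewrite ge0_integral_pushforward.
rewrite (eq_measure_integral (PG \x D)%E); last first.
  by move=> C mC _; apply/esym/product_measure_unique.
rewrite fubini_tonelli1 // ge0_integral_pushforward //.
  exact: measurable_fun_fubini_tonelli_F.
by move=> om _; exact: integral_ge0.
Qed.

End IndependentTonelli.

(** The form is a finite linear combination of the integrable entries of [Z], and the constant [a]
    keeps its value because [mu] has mass 1. *)
Lemma integral_bform (R : realType) d (T : measurableType d)
    (mu : probability T R) n (Z : T -> 'M[R]_n) (v : 'cV[R]_n) (a c : R) :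
  (forall i j, mu.-integrable setT (fun t => (Z t i j)%:E)) ->
  (\int[mu]_t (a - c * bform (Z t) v v)%:E =
  (a - c * bform (\matrix_(i, j) fine (\int[mu]_t (Z t i j)%:E)) v v)%:E)%E.
Proof.
move=> iZ; pose f (ij : 'I_n * 'I_n) t :=
  ((v ij.1 0 * v ij.2 0)%:E * (Z t ij.1 ij.2)%:E)%E.
have fE t : (bform (Z t) v v)%:E = (\sum_ij f ij t)%E.
  rewrite bform_sum pair_bigA -sumEFin; apply: eq_bigr => ij _.
  by rewrite /f -EFinM.
have i_f ij : mu.-integrable setT (f ij) by exact: integrableZl.
have isum : mu.-integrable setT (fun t => (bform (Z t) v v)%:E).
  rewrite (_ : (fun t => _) = (fun t => \sum_ij f ij t)%E); last exact/funext.
  exact: integrable_sum.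
under eq_integral do rewrite EFinB.
rewrite integralB_EFin //=; first last.
- rewrite (_ : _ \o _ = fun t => c%:E * (bform (Z t) v v)%:E)%E;
    last exact/funext.
  exact: integrableZl.
- exact: finite_measure_integrable_cst.
rewrite EFinB; congr (_ - _)%E.
  apply: etrans (integral_cst mu measurableT a%:E) _.
  by rewrite -[RHS]mule1; congr (_ * _)%E; exact: probability_setT.
under eq_integral do rewrite EFinM.
rewrite integralZl // EFinM; congr (_ * _)%E.
under eq_integral do rewrite fE.
rewrite integral_sum // bform_sum pair_bigA -sumEFin; apply: eq_bigr => ij _.
rewrite integralZl // mxE [RHS]EFinM; congr (_ * _)%E.
by rewrite fineK //; exact: integrable_fin_num.
Qed.

(** * Mean-square contraction *)

Section Contraction.
Variables (R : realType) (m n : nat) (A : 'M[R]_(m, n)) (B : 'M[R]_n).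
Variables (dT : measure_display) (T : measurableType dT) (D : probability T R).
Variable smat : T -> {p : nat & 'M[R]_(m, p)}.
Variables (w lam : R).
Let rho := 1 - w * (2 - w) * lam.
Let EZ : 'M[R]_n := \matrix_(i, j) fine (\int[D]_t (Zof A B (smat t) i j)%:E).
Hypothesis pB : posdef B.
Hypothesis mH : forall i j, measurable_fun setT (fun t => Hof A B (smat t) i j).
Hypothesis iZ :
  forall i j, D.-integrable setT (fun t => (Zof A B (smat t) i j)%:E).
Hypothesis exactEZ : forall v : 'cV[R]_n, EZ *m v = 0 <-> A *m v = 0.
Hypothesis lamW : min_pos_eig (inv_sqrt_mx B *m EZ *m inv_sqrt_mx B) lam.
Hypothesis w02 : 0 < w < 2.

Lemma EZ_sym : EZ^T = EZ.
Proof.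
apply/matrixP => i j; rewrite !mxE; congr fine; apply: eq_integral => t _.
by rewrite -[in LHS](Zof_sym A pB) mxE.
Qed.

(** One error-free iteration, written for the offset [u = y - ystar]. *)
Definition exact_step (t : T) (u : 'cV[R]_m) :=
  u - w *: (Hof A B (smat t) *m (gram A B *m u)).

Lemma expected_exact_step u :
  (\int[D]_t (bform (gram A B) (exact_step t u) (exact_step t u))%:E
    <= (Num.sqrt rho ^+ 2 * bform (gram A B) u u)%:E)%E.
Proof.
under eq_integral do rewrite (bform_gram_step A pB).
rewrite integral_bform // lee_fin -/EZ.
have gap := spectral_gap u EZ_sym (fun v => (exactEZ v).1) lamW.
have u0 := gram_psd A pB u.
have c0 : 0 <= w * (2 - w).
  by case/andP: w02 => w0 w2; rewrite mulr_ge0 // ?subr_ge0 ltW.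
apply: (@le_trans _ _ (rho * bform (gram A B) u u)).
  by rewrite /rho mulrBl mul1r lerD2l lerN2 -(mulrA (w * (2 - w))) ler_wpM2l.
(* [Num.sqrt] vanishes on negative reals, so [Num.sqrt rho ^+ 2] bounds [rho] from above for either
   sign. *)
rewrite ler_wpM2r //; have [r0|r0] := leP 0 rho; first by rewrite sqr_sqrtr.
by rewrite (le_trans (ltW r0)) // sqr_ge0.
Qed.

Variables (dO : measure_display) (Om : measurableType dO).
Variables (P : probability Om R) (S : Om -> T) (G : set (set Om)).
Hypothesis mG : G `<=` measurable.
Hypothesis mS : measurable_fun setT S.
Hypothesis lawS : forall C, measurable C -> P (S @^-1` C) = D C.
Hypothesis indSG : indep P <<s preim_rv S>> <<s G>>.

(** The domain type makes [u] measurable for the sigma-algebra of [G], which is independent of [S];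
    so [u] can be frozen and [expected_exact_step] integrated pointwise. *)
Lemma exact_step_contraction (u : g_sigma_algebraType G -> 'cV[R]_m) :
  measurable_mx u ->
  (\int[P]_om (bform (gram A B) (exact_step (S om) (u om))
                                (exact_step (S om) (u om)))%:E
    <= (Num.sqrt rho ^+ 2)%:E *
       \int[P]_om (bform (gram A B) (u om) (u om))%:E)%E.
Proof.
move=> mu.
pose h (z : g_sigma_algebraType G * T) :=
  exact_step z.2 (u z.1).
have mh : measurable_mx h.
  have m1 : measurable_mx (fun z : g_sigma_algebraType G * T => u z.1).
    exact: (measurable_mx_comp measurable_fst mu).
  have m2 : measurable_mx
      (fun z : g_sigma_algebraType G * T => Hof A B (smat z.2)).
    exact: (measurable_mx_comp measurable_snd
      (F := fun t => Hof A B (smat t)) mH).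
  apply: measurable_mxB => //; apply: measurable_mxZ.
  apply: measurable_mxM => //.
  by apply: measurable_mxM => //; exact: measurable_mx_cst.
have mg : measurable_fun setT (fun z => (bform (gram A B) (h z) (h z))%:E).
  by apply/measurable_EFinP; apply: measurable_bform => //;
    exact: measurable_mx_cst.
have g0 z : (0 <= (bform (gram A B) (h z) (h z))%:E)%E.
  by rewrite lee_fin; exact: gram_psd.
rewrite (ge0_integral_indep mG mS lawS indSG mg g0).
have mGid := measurable_id_g_sigma mG.
have muO :
  measurable_fun setT (fun om : Om => (bform (gram A B) (u om) (u om))%:E).
  have mu' : measurable_mx (fun om : Om => u om).
    by move=> i j; apply: measurableT_comp (mu i j) mGid.
  by apply/measurable_EFinP; apply: measurable_bform => //;
    exact: measurable_mx_cst.
rewrite -ge0_integralZl_EFin ?sqr_ge0 //; last first.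
  by move=> om _; rewrite lee_fin; exact: gram_psd.
apply: ge0_le_integral => //.
- by move=> om _; apply: integral_ge0 => t _; rewrite lee_fin; exact: gram_psd.
- exact: (measurableT_comp (measurable_fun_fubini_tonelli_F _ mg g0) mGid).
- exact: measurable_funeM.
- move=> om _; have := expected_exact_step (u om); rewrite EFinM.
  exact: le_trans.
Qed.

End Contraction.

(* Optimal weight s = q / r in (a + c)^2 <= (1 + s) a^2 + (1 + s^-1) c^2; the
   slack e covers the degenerate cases r = 0 and q = 0. *)
Lemma young_weight (R : realFieldType) (r q : R) : 0 <= r -> 0 <= q ->
  forall e, 0 < e -> exists2 s, 0 < s &
    (1 + s) * r ^+ 2 + (1 + s^-1) * q ^+ 2 <= (r + q) ^+ 2 + e.
Proof.
move=> r0 q0 e e0; have [r1|r1] := eqVneq r 0.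
  have q2 : 0 <= q ^+ 2 by exact: sqr_ge0.
  (* The excess is [s^-1 q^2 = e q^2 / (q^2 + 1) <= e]; the case [q = 0] below is symmetric. *)
  exists ((q ^+ 2 + 1) / e); first by rewrite divr_gt0 // ltr_wpDl.
  rewrite r1 invf_div expr0n mulr0 !add0r mulrDl mul1r lerD2l.
  by rewrite mulrAC ler_pdivrMr ?ltr_wpDl // ler_wpM2l ?(ltW e0) // lerDl.
have [q1|q1] := eqVneq q 0.
  have r2 : 0 <= r ^+ 2 by exact: sqr_ge0.
  exists (e / (r ^+ 2 + 1)); first by rewrite divr_gt0 // ltr_wpDl.
  rewrite q1 expr0n mulr0 !addr0 mulrDl mul1r lerD2l.
  by rewrite mulrAC ler_pdivrMr ?ltr_wpDl // ler_wpM2l ?(ltW e0) // lerDl.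
exists (q / r); first by rewrite divr_gt0 // lt_def ?r1 ?q1.
rewrite [leLHS](_ : _ = (r + q) ^+ 2) ?lerDl ?(ltW e0) //.
by field; rewrite r1 q1.
Qed.

Section Minkowski.
Variables (R : realType) (d : measure_display) (Om : measurableType d).
Variables (P : probability Om R) (m : nat) (M : 'M[R]_m).
Hypothesis symM : M^T = M.
Hypothesis psdM : forall x : 'cV_m, 0 <= bform M x x.

Let measurable_sq (x : Om -> 'cV[R]_m) :
  measurable_mx x -> measurable_fun setT (fun om => (bform M (x om) (x om))%:E).
Proof.
by move=> mx; apply/measurable_EFinP; apply: measurable_bform => //;
  exact: measurable_mx_cst.
Qed.

(** The triangle inequality in [L^2], stated on squares: Young's inequality is integrated with a
    nearly optimal weight, up to an arbitrary slack [e]. *)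
Lemma minkowski_bform (x y : Om -> 'cV[R]_m) (r q f : R) :
  measurable_mx x -> measurable_mx y -> 0 <= r -> 0 <= q -> 0 <= f ->
  (\int[P]_om (bform M (x om) (x om))%:E <= (r ^+ 2 * f)%:E)%E ->
  (\int[P]_om (bform M (y om) (y om))%:E <= (q ^+ 2 * f)%:E)%E ->
  (\int[P]_om (bform M (x om + y om) (x om + y om))%:E
     <= ((r + q) ^+ 2 * f)%:E)%E.
Proof.
move=> mx my r0 q0 f0 xr yq; apply/lee_addgt0Pr => e e0.
have f1 : 0 < f + 1 by rewrite ltr_wpDl.
(* The slack gets multiplied by [f], and [f e / (f + 1) <= e] even for [f = 0]. *)
have [s s0 srq] := young_weight r0 q0 (divr_gt0 e0 f1).
have si0 : 0 < s^-1 by rewrite invr_gt0.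
have c0 : 0 <= 1 + s by rewrite addr_ge0 // ltW.
have d0 : 0 <= 1 + s^-1 by rewrite addr_ge0 // ltW.
have mxs := measurable_sq mx; have mys := measurable_sq my.
apply: (@le_trans _ _ (\int[P]_om ((1 + s)%:E * (bform M (x om) (x om))%:E +
    (1 + s^-1)%:E * (bform M (y om) (y om))%:E))%E).
  apply: ge0_le_integral => //.
  - by move=> om _; rewrite lee_fin.
  - by apply: measurable_sq; exact: measurable_mxD.
  - by apply: emeasurable_funD; exact: measurable_funeM.
  - by move=> om _; rewrite -!EFinM -EFinD lee_fin; exact: bform_add_young.
rewrite ge0_integralD //; first last.
- exact: measurable_funeM.
- by move=> om _; rewrite mule_ge0 // lee_fin.
- exact: measurable_funeM.
- by move=> om _; rewrite mule_ge0 // lee_fin.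
rewrite !ge0_integralZl_EFin //; try by move=> om _; rewrite lee_fin.
apply: (@le_trans _ _ ((1 + s)%:E * (r ^+ 2 * f)%:E
    + (1 + s^-1)%:E * (q ^+ 2 * f)%:E)%E).
  by rewrite leeD // lee_wpmul2l ?lee_fin.
rewrite -!EFinM -!EFinD lee_fin (mulrA (1 + s)) (mulrA (1 + s^-1)).
rewrite -mulrDl.
apply: (@le_trans _ _ (((r + q) ^+ 2 + e / (f + 1)) * f)).
  by rewrite ler_wpM2r.
rewrite mulrDl lerD2l mulrAC ler_pdivrMr // ler_wpM2l ?(ltW e0) //.
by rewrite lerDl.
Qed.

End Minkowski.

Theorem mainTheorem13 (R : realType) (m n : nat)
  (A : 'M[R]_(m, n)) (B : 'M[R]_n) (b : 'cV[R]_m) (x0 : 'cV[R]_n)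
  (* distribution D of the sketching matrices: samples t : T, realised as
     matrices smat t with m rows and any number of columns *)
  (dT : measure_display) (T : measurableType dT) (D : probability T R)
  (smat : T -> {p : nat & 'M[R]_(m, p)})
  (* underlying probability space, sketches S_k, errors eps_d^k *)
  (dO : measure_display) (Om : measurableType dO) (P : probability Om R)
  (S : nat -> Om -> T) (eps : nat -> Om -> 'cV[R]_m)
  (w q lam : R) (ystar : 'cV[R]_m) :
  posdef B ->
  (exists x : 'cV[R]_n, A *m x = b) ->
  A != 0 ->
  (* E[Z] finite; random matrices are measurable *)
  (forall i j, measurable_fun setT (fun t => Hof A B (smat t) i j)) ->
  (forall i j, D.-integrable setT (fun t => (Zof A B (smat t) i j)%:E)) ->
  let EZ : 'M[R]_n := \matrix_(i, j) fine (\int[D]_t (Zof A B (smat t) i j)%:E) in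
  let W := inv_sqrt_mx B *m EZ *m inv_sqrt_mx B in
  (* exactness: Null(E[Z]) = Null(A) *)
  (forall v : 'cV[R]_n, EZ *m v = 0 <-> A *m v = 0) ->
  min_pos_eig W lam ->
  (* S_k i.i.d. with law D *)
  (forall k, measurable_fun setT (S k)) ->
  (forall k C, measurable C -> P (S k @^-1` C) = D C) ->
  mutually_indep P (fun k => <<s preim_rv (S k)>>) ->
  (forall k i, measurable_fun setT (fun om => eps k om i 0)) ->
  0 < w < 2 ->
  let rho := 1 - w * (2 - w) * lam in
  0 <= q -> q < 1 - Num.sqrt rho ->
  (forall y, dualf A B b x0 y <= dualf A B b x0 ystar) ->
  let y := fun k om =>
    isdsa A B b x0 w (fun j => Hof A B (smat (S j om))) (fun j => eps j om) k in
  (* S_k independent of y^k *)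
  (forall k, indep P <<s preim_rv (S k)>> <<s preim_vec (y k)>>) ->
  (* E[ ||B^{-1} A^T eps_d^k||_B^2 | y^k, S_k ] <= 2 q^2 (D(ystar) - D(y^k)) *)
  (forall k, cond_exp_le P <<s (preim_vec (y k) `|` preim_rv (S k)) >>
     (fun om => sqnormB B (invmx B *m A^T *m eps k om))
     (fun om => 2 * q ^+ 2 * (dualf A B b x0 ystar - dualf A B b x0 (y k om)))) ->
  forall k : nat,
    (\int[P]_om (dualf A B b x0 ystar - dualf A B b x0 (y k om))%:E
     <= ((Num.sqrt rho + q) ^+ (2 * k)
         * (dualf A B b x0 ystar - dualf A B b x0 0))%:E)%E.
Proof.
move=> pB _ _ mH iZ EZ W exactEZ lamW mS lawS _ meps w02 rho q0 _ ymax y indSy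
  eps_le.
pose M := gram A B; pose gap k om := bform M (y k om - ystar) (y k om - ystar).
have symM : M^T = M by exact: gram_sym.
have psdM x : 0 <= bform M x x by exact: gram_psd.
have gap_ge0 k om : 0 <= gap k om by exact: psdM.
have gapE k om :
    dualf A B b x0 ystar - dualf A B b x0 (y k om) = 2^-1 * gap k om.
  exact: dual_gap.
have mHS k : measurable_mx (fun om => Hof A B (smat (S k om))).
  exact: (measurable_mx_comp (mS k) (F := fun t => Hof A B (smat t)) mH).
have meps' k : measurable_mx (eps k) by move=> i j; rewrite (ord1 j).
(* Stationarity replaces [b - A x0] by [gram ystar], so the recursion closes on the offset from
   [ystar]. *)
have yS k om : y k.+1 om - ystar =
    exact_step A B smat w (S k om) (y k om - ystar) + eps k om.
  have -> : y k.+1 om = y k om + w *: (Hof A B (smat (S k om)) *m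
      (b - A *m (x0 + invmx B *m A^T *m y k om))) + eps k om by [].
  rewrite /exact_step (mulmxBr (gram A B)) (dual_max_stationary pB ymax).
  have -> : b - A *m (x0 + invmx B *m A^T *m y k om) =
      - (gram A B *m y k om - (b - A *m x0)).
    by rewrite opprB mulmxDr opprD addrA /gram !mulmxA.
  by rewrite mulmxN scalerN addrAC; congr (_ + _); rewrite addrAC.
have mB d' (X : measurableType d') (Y : X -> 'cV_m) :
    measurable_mx Y -> measurable_mx (fun x => Y x - ystar).
  by move=> mY; apply: measurable_mxB => //; exact: measurable_mx_cst.
have mstep k : measurable_mx (y k) ->
    measurable_mx (fun om => exact_step A B smat w (S k om) (y k om - ystar)).
  move=> /mB mY; apply: measurable_mxB => //.
  apply: measurable_mxZ; apply: measurable_mxM => //.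
  by apply: measurable_mxM => //; exact: measurable_mx_cst.
have my k : measurable_mx (y k).
  elim: k => [|k IH]; first exact: measurable_mx_cst.
  rewrite (_ : y k.+1 = fun om => exact_step A B smat w (S k om)
      (y k om - ystar) + eps k om + ystar);
    last by apply/funext => om; rewrite -yS subrK.
  apply: measurable_mxD; last exact: measurable_mx_cst.
  by apply: measurable_mxD => //; exact: mstep.
have mgap k : measurable_fun setT (fun om => (gap k om)%:E).
  by apply/measurable_EFinP; apply: measurable_bform (mB _ _ _ (my k))
    (mB _ _ _ (my k)); exact: measurable_mx_cst.
have preim_measurable k : preim_vec (y k) `<=` measurable.
  by move=> _ [i [C [mC ->]]]; rewrite -[X in measurable X]setTI; exact: my.
have my_preim k :
    measurable_mx (y k : g_sigma_algebraType (preim_vec (y k)) -> _).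
  move=> i j _ C mC; rewrite setTI (ord1 j).
  by apply: sub_sigma_algebra; exists i, C.
(* The induction runs on twice the dual gap; at [k = 0] the iterate is the constant 0, so the
   integrand is constant. *)
have gap_rate k : (\int[P]_om (gap k om)%:E <=
    ((Num.sqrt rho + q) ^+ (2 * k) * bform M (0 - ystar) (0 - ystar))%:E)%E.
  elim: k => [|k IH].
    rewrite muln0 expr0 mul1r /gap /=.
    set c := bform M _ _.
    have -> // : (\int[P]_(_ in setT) c%:E = c%:E)%E.
    apply: etrans (integral_cst P measurableT c%:E) _.
    by rewrite -[RHS]mule1; congr (_ * _)%E; exact: probability_setT.
  set f := (_ ^+ _ * _) in IH.
  have f0 : 0 <= f by rewrite mulr_ge0 // exprn_ge0 // addr_ge0 // sqrtr_ge0.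
  rewrite mulnS exprD -mulrA -/f.
  rewrite /gap; under eq_integral do rewrite yS.
  apply: minkowski_bform => //; first last.
  (* The event [setT] turns the conditional bound into a bound in mean, and its factor 2 cancels the
     one half in the dual gap. *)
  - have := eps_le k setT (@measurableT _ (g_sigma_algebraType _)).
    under eq_integral do rewrite (sqnormB_gram A pB); move/le_trans; apply.
    under eq_integral do rewrite gapE mulrA (mulrAC 2) mulfV // mul1r EFinM.
    rewrite ge0_integralZl_EFin ?sqr_ge0 //; last first.
      by move=> om _; rewrite lee_fin.
    by rewrite [leRHS]EFinM lee_wpmul2l // lee_fin sqr_ge0.
  - have := exact_step_contraction pB mH iZ exactEZ lamW w02
      (preim_measurable k) (mS k) (lawS k) (indSy k) (mB _ _ _ (my_preim k)).
    move/le_trans; apply.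
    by rewrite [leRHS]EFinM lee_wpmul2l // lee_fin sqr_ge0.
  - exact: mstep.
move=> k; under eq_integral do rewrite gapE EFinM.
rewrite ge0_integralZl_EFin ?invr_ge0 //; last by move=> om _; rewrite lee_fin.
by rewrite (dual_gap pB ymax) mulrCA [leRHS]EFinM lee_wpmul2l // lee_fin
  invr_ge0.
Qed.
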